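(* Let $\tau$ be an $n$-dimensional simplex in $n$-dimensional Euclidean space $E^n$ with vertices $A_1, A_2, \dots, A_{n+1}$. Then for every point $P \in \tau$, $$\sum_{i=1}^{n+1}\|PA_i\| \;\leq\; \sup_{i_t, j_t \in \{1,2,\dots,n+1\}}\left\{\sum_{t=1}^{n}\|A_{i_t}A_{j_t}\|\right\},$$ where the supremum is over all choices of indices $i_1,j_1,\dots,i_n,j_n \in \{1,2,\dots,n+1\}$.
   Context: $\|AB\|$ denotes the Euclidean distance between points $A$ and $B$. The simplex $\tau$ is the (closed, nondegenerate) convex hull of its vertices, so $P$ may lie in the interior or on the boundary of $\tau$. *)

(* Defs.v *)
From mathcomp Require Import all_boot all_order all_algebra.
From mathcomp Require Import all_classical all_reals.

Set Implicit Arguments.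
Unset Strict Implicit.
Unset Printing Implicit Defensive.

Import Order.TTheory GRing.Theory Num.Theory.

Local Open Scope classical_set_scope.
Local Open Scope ring_scope.

(* The norm that the library puts on ['rV[R]_n] is the max norm, hence this
   explicit Euclidean distance. *)
Definition edist (R : realType) (n : nat) (x y : 'rV[R]_n) : R :=
  Num.sqrt (\sum_(k < n) (x 0 k - y 0 k) ^+ 2).

(* The points [A 0, ..., A m] are affinely independent iff the [m] vectors
   [A i - A 0], [0 < i], are linearly independent. *)
Definition affinely_independent (R : realType) (n m : nat)
    (A : 'I_m.+1 -> 'rV[R]_n) : bool :=
  free [seq A (lift ord0 i) - A ord0 | i : 'I_m].

Definition convex_hull (R : realType) (n m : nat)
    (A : 'I_m -> 'rV[R]_n) : set 'rV[R]_n :=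
  [set P | exists w : 'I_m -> R,
    [/\ forall i, 0 <= w i, \sum_(i < m) w i = 1
      & P = \sum_(i < m) w i *: A i]].

(* Main.v *)
Require Import Defs.
From mathcomp Require Import all_boot all_order all_algebra.
From mathcomp Require Import all_classical all_reals.
From mathcomp Require Import ring.

Set Implicit Arguments.
Unset Strict Implicit.
Unset Printing Implicit Defensive.

Import Order.TTheory GRing.Theory Num.Theory.

Local Open Scope classical_set_scope.
Local Open Scope ring_scope.

(** Let [D] be the largest distance between two vertices.  As the index pairs
    may repeat, taking one diametral pair [n] times shows that the supremum is
    at least [n * D].  On the other side, if [P = \sum_j w j *: A j] is a convex
    combination, then [P - A i = \sum_(j != i) w j *: (A j - A i)] has weights
    of total mass [1 - w i] and vectors of length at most [D], so that
    [edist P (A i) <= (1 - w i) * D] ([edist_convex_comb_vertex]).  Summing over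
    the [n + 1] vertices gives [(n + 1 - 1) * D = n * D].

    The only analytic input is convexity of the Euclidean norm.  It is obtained
    at the level of squares, one coordinate at a time, from the weighted
    Cauchy-Schwarz inequality [sqr_weighted_sum_le]. *)

(** Lagrange's identity: the difference of the two sides is half of
    [\sum_(j, k) w j * w k * (x j - x k) ^+ 2]. *)
Lemma sqr_weighted_sum_le (R : realFieldType) (I : finType) (Q : pred I)
    (w x : I -> R) (w_ge0 : forall i, 0 <= w i) :
  (\sum_(j | Q j) w j * x j) ^+ 2 <=
  (\sum_(j | Q j) w j) * (\sum_(j | Q j) w j * x j ^+ 2).
Proof.
set m := \sum_(j | Q j) w j * x j; set S := \sum_(j | Q j) w j.
set q := \sum_(j | Q j) w j * x j ^+ 2.
have lagrange : \sum_(j | Q j) \sum_(k | Q k) w j * w k * (x j - x k) ^+ 2 =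
    (S * q - m ^+ 2) *+ 2.
  have inner j : \sum_(k | Q k) w j * w k * (x j - x k) ^+ 2 =
      w j * x j ^+ 2 * S + w j * q - w j * x j * (m *+ 2).
    rewrite -sumrMnl !mulr_sumr -big_split -sumrB /=.
    by apply: eq_bigr => k _; ring.
  under eq_bigr do rewrite inner.
  by rewrite sumrB big_split /= -!mulr_suml -/S -/q -/m; ring.
rewrite -subr_ge0 -(pmulrn_lge0 _ (isT : (0 < 2)%N)) -lagrange.
apply: sumr_ge0 => j _; apply: sumr_ge0 => k _.
by rewrite mulr_ge0 ?sqr_ge0 ?mulr_ge0.
Qed.

Lemma edist_ge0 (R : realType) (n : nat) (x y : 'rV[R]_n) : 0 <= edist x y.
Proof. exact: sqrtr_ge0. Qed.

Lemma sqr_edist (R : realType) (n : nat) (x y : 'rV[R]_n) :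
  edist x y ^+ 2 = \sum_(k < n) (x 0 k - y 0 k) ^+ 2.
Proof. by rewrite sqr_sqrtr // sumr_ge0 // => k _; rewrite sqr_ge0. Qed.

(** The gain over the trivial bound [D] is the factor [1 - w i]: the vertex
    [A i] contributes nothing to the displacement of the combination from
    [A i]. *)
Lemma edist_convex_comb_vertex (R : realType) (n m : nat)
    (A : 'I_m -> 'rV[R]_n) (w : 'I_m -> R) (D : R) (i : 'I_m)
    (w_ge0 : forall j, 0 <= w j) (w_sum1 : \sum_(j < m) w j = 1)
    (A_le : forall j, edist (A j) (A i) <= D) :
  edist (\sum_(j < m) w j *: A j) (A i) <= (1 - w i) * D.
Proof.
have D_ge0 : 0 <= D := le_trans (edist_ge0 _ _) (A_le i).
have massE : \sum_(j | j != i) w j = 1 - w i.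
  by rewrite -w_sum1 [in RHS](bigD1 i) //= addrAC subrr add0r.
have mass_ge0 : 0 <= 1 - w i by rewrite -massE sumr_ge0.
have coordE k : (\sum_(j < m) w j *: A j) 0 k - A i 0 k =
    \sum_(j | j != i) w j * (A j 0 k - A i 0 k).
  rewrite summxE -[A i 0 k in LHS]mul1r -w_sum1 mulr_suml -sumrB.
  rewrite (bigD1 i) //= !mxE subrr add0r.
  by apply: eq_bigr => j _; rewrite !mxE mulrBr.
rewrite -(ler_pXn2r (isT : (0 < 2)%N)) ?nnegrE ?edist_ge0 ?mulr_ge0 //.
rewrite sqr_edist.
have coord_le k : true -> ((\sum_(j < m) w j *: A j) 0 k - A i 0 k) ^+ 2 <=
    (1 - w i) * \sum_(j | j != i) w j * (A j 0 k - A i 0 k) ^+ 2.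
  by move=> _; rewrite coordE -massE; apply: sqr_weighted_sum_le.
apply: (le_trans (ler_sum _ coord_le)).
rewrite -mulr_sumr exchange_big /= exprMn expr2 -mulrA ler_wpM2l //.
rewrite -massE mulr_suml; apply: ler_sum => j _.
rewrite -mulr_sumr -sqr_edist ler_wpM2l //.
by rewrite ler_pXn2r ?nnegrE ?edist_ge0.
Qed.

Theorem lemma2p2 (R : realType) (n : nat) (A : 'I_n.+1 -> 'rV[R]_n)
    (A_nondegenerate : affinely_independent A)
    (P : 'rV[R]_n) (P_in_simplex : convex_hull A P) :
  \sum_(i < n.+1) edist P (A i) <=
  sup [set s : R | exists i j : 'I_n -> 'I_n.+1,
         s = \sum_(t < n) edist (A (i t)) (A (j t))].
Proof.
case: P_in_simplex => w [w_ge0 w_sum1 ->].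
pose d (p : 'I_n.+1 * 'I_n.+1) := edist (A p.1) (A p.2).
have [[a b] _ ab_max] := @Order.TotalTheory.arg_maxP _ _ _ (ord0, ord0) predT d isT.
set D := d (a, b) in ab_max.
have le_D i j : edist (A i) (A j) <= D by apply: (ab_max (i, j)).
apply: (@le_trans _ _ (D *+ n)).
  have vertex_le i : true ->
      edist (\sum_(j < n.+1) w j *: A j) (A i) <= (1 - w i) * D.
    by move=> _; apply: edist_convex_comb_vertex.
  apply: (le_trans (ler_sum _ vertex_le)).
  rewrite -mulr_suml sumrB w_sum1 sumr_const card_ord.
  by rewrite mulrSr addrK mulr_natl.
apply: ub_le_sup; last first.
  by exists (fun=> a), (fun=> b); rewrite sumr_const card_ord.
exists (D *+ n) => _ [i [j ->]].
by rewrite -[n in leRHS]card_ord -sumr_const ler_sum.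
Qed.
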